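(* Let $(\mathbf x_k,\mathbf z_k,\boldsymbol\lambda_k)_{k\ge 0}$, $\boldsymbol\lambda_k=[\boldsymbol\alpha_k;\boldsymbol\beta_k]$, be generated by the DQM recursion (see context) with penalty constant $c$, and suppose the following hold. (1) Initialization: $\boldsymbol\alpha_0=-\boldsymbol\beta_0$, $\mathbf E_u\mathbf x_0=2\mathbf z_0$, and $\boldsymbol\alpha_0$ lies in the column space of $\mathbf E_o$. (2) Network: every singular value $\sigma(\mathbf E_u)$ of $\mathbf E_u$ satisfies $0<\gamma_u\le\sigma(\mathbf E_u)\le\Gamma_u$ for constants $\gamma_u,\Gamma_u$, and $\gamma_o>0$ is the smallest non-zero singular value of $\mathbf E_o$. (3) Each $f_i$ is twice differentiable and there are constants $0<m\le M<\infty$ with $m\mathbf I\preceq\nabla^2 f_i(\mathbf y)\preceq M\mathbf I$ for all $\mathbf y\in\mathbb R^p$ and all $i$. (4) There is a constant $L$ with $\|\nabla^2 f_i(\mathbf y)-\nabla^2 f_i(\hat{\mathbf y})\|\le L\|\mathbf y-\hat{\mathbf y}\|$ for all $\mathbf y,\hat{\mathbf y}\in\mathbb R^p$ and all $i$. (5) $c>4M^2/(m\gamma_u^2)$. Then the sequence $\|\mathbf x_k-\mathbf x^*\|^2$ converges R-linearly to zero (it is dominated by a sequence converging linearly to zero); namely, for all $k\ge 0$, $$\|\mathbf x_k-\mathbf x^*\|^2\le\frac{4}{c\gamma_u^2}\,\|\mathbf u_k-\mathbf u^*\|_{\mathbf C}^2 .$$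
   Context: Network and matrices. Consider a connected network with node set $\mathcal V=\{1,\dots,n\}$ and a set $\mathcal E$ of $r$ ordered edges $(i,j)$, symmetric in the sense that $(i,j)\in\mathcal E$ iff $(j,i)\in\mathcal E$. The block source matrix $\mathbf A_s\in\mathbb R^{rp\times np}$ consists of $r\times n$ blocks of size $p\times p$, indexed by edges $e$ and nodes $i$: $(\mathbf A_s)_{e,i}=\mathbf I_p$ if $e=(i,j)\in\mathcal E$ for some $j$, and $\mathbf 0$ otherwise. The block destination matrix $\mathbf A_d\in\mathbb R^{rp\times np}$ has $(\mathbf A_d)_{e,i}=\mathbf I_p$ if $e=(j,i)\in\mathcal E$ for some $j$, and $\mathbf 0$ otherwise. Set $\mathbf A=[\mathbf A_s;\mathbf A_d]\in\mathbb R^{2rp\times np}$ and $\mathbf B=[-\mathbf I_{rp};-\mathbf I_{rp}]\in\mathbb R^{2rp\times rp}$ (semicolons denote vertical stacking), $\mathbf E_o=\mathbf A_s-\mathbf A_d$ (oriented incidence matrix), $\mathbf E_u=\mathbf A_s+\mathbf A_d$ (unoriented incidence matrix). Objective. $f_i:\mathbb R^p\to\mathbb R$ are the local costs; for $\mathbf x=[\mathbf x_1;\dots;\mathbf x_n]\in\mathbb R^{np}$, $f(\mathbf x)=\sum_{i=1}^n f_i(\mathbf x_i)$. The problem is $\min_{\mathbf x,\mathbf z} f(\mathbf x)$ subject to $\mathbf A\mathbf x+\mathbf B\mathbf z=\mathbf 0$, with $\mathbf z\in\mathbb R^{rp}$; $(\mathbf x^*,\mathbf z^* )$ denotes its unique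 solution. $\boldsymbol\alpha^*$ denotes the unique vector in the column space of $\mathbf E_o$ such that $\boldsymbol\lambda^*=[\boldsymbol\alpha^*;-\boldsymbol\alpha^*]$ is an optimal Lagrange multiplier, i.e. $\nabla f(\mathbf x^* )+\mathbf A^T\boldsymbol\lambda^*=\mathbf 0$ (such a vector exists and is unique). DQM recursion with constant $c>0$: with $\mathbf H_k=\nabla^2 f(\mathbf x_k)$ and $\boldsymbol\lambda_k=[\boldsymbol\alpha_k;\boldsymbol\beta_k]$, $\boldsymbol\alpha_k,\boldsymbol\beta_k\in\mathbb R^{rp}$, for all $k\ge 0$ the iterates $\mathbf x_{k+1},\mathbf z_{k+1},\boldsymbol\lambda_{k+1}$ are determined by $$\nabla f(\mathbf x_k)+\mathbf H_k(\mathbf x_{k+1}-\mathbf x_k)+\mathbf A^T\boldsymbol\lambda_k+c\mathbf A^T(\mathbf A\mathbf x_{k+1}+\mathbf B\mathbf z_k)=\mathbf 0,$$ $$\mathbf B^T\boldsymbol\lambda_k+c\mathbf B^T(\mathbf A\mathbf x_{k+1}+\mathbf B\mathbf z_{k+1})=\mathbf 0,\qquad \boldsymbol\lambda_{k+1}-\boldsymbol\lambda_k-c(\mathbf A\mathbf x_{k+1}+\mathbf B\mathbf z_{k+1})=\mathbf 0.$$ Energy. $\mathbf u_k=[\mathbf z_k;\boldsymbol\alpha_k]$, $\mathbf u^*=[\mathbf z^*;\boldsymbol\alpha^*]$, $\mathbf C=\mathrm{diag}(c\mathbf I_{rp},(1/c)\mathbf I_{rp})$, and $\|\mathbf a\|_{\mathbf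 C}^2=\mathbf a^T\mathbf C\mathbf a$, so $\|\mathbf u_k-\mathbf u^*\|_{\mathbf C}^2=c\|\mathbf z_k-\mathbf z^*\|^2+\frac1c\|\boldsymbol\alpha_k-\boldsymbol\alpha^*\|^2$. Norms are Euclidean for vectors and spectral for matrices. *)

(* Defs.v *)
(* MathComp / MathComp-Analysis. *)
From mathcomp Require Import all_boot all_order all_algebra.
From mathcomp Require Import all_classical all_reals all_analysis.

Set Implicit Arguments.
Unset Strict Implicit.
Unset Printing Implicit Defensive.

Import Order.TTheory GRing.Theory Num.Theory.
Import numFieldNormedType.Exports.

Local Open Scope ring_scope.

Definition enorm (R : realType) (N : nat) (v : 'cV[R]_N) : R :=
  Num.sqrt ((v^T *m v) 0 0).

Definition wnorm2 (R : realType) (N : nat) (C : 'M[R]_N) (v : 'cV[R]_N) : R :=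
  (v^T *m C *m v) 0 0.

(* [A] has one singular value per column, with multiplicity: when m < n this
   includes the n - m trailing zeros that some authors leave out. *)
Definition singular_value (R : realType) (m n : nat) (A : 'M[R]_(m, n)) (s : R) :
  Prop := 0 <= s /\ eigenvalue (A^T *m A) (s ^+ 2).

Definition spectral_norm (R : realType) (m n : nat) (A : 'M[R]_(m, n)) : R :=
  sup [set s | singular_value A s]%classic.

Definition psd (R : realType) (N : nat) (A : 'M[R]_N) : Prop :=
  A^T = A /\ forall v : 'cV[R]_N, 0 <= (v^T *m A *m v) 0 0.

(* Only used with [A] or [B] scalar, so symmetry of [B - A] amounts to
   symmetry of both matrices. *)
Definition loewner_le (R : realType) (N : nat) (A B : 'M[R]_N) : Prop :=
  psd (B - A).

Definition in_colspace (R : realType) (m n : nat) (A : 'M[R]_(m, n))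
  (v : 'cV[R]_m) : Prop := exists w : 'cV[R]_n, v = A *m w.

Definition grad (R : realType) (N : nat) (f : 'cV[R]_N -> R) (x : 'cV[R]_N) :
  'cV[R]_N := \col_i 'D_(delta_mx i 0) f x.

Definition hessian (R : realType) (N : nat) (f : 'cV[R]_N -> R) (x : 'cV[R]_N) :
  'M[R]_N := \matrix_(i, j) ('D_(delta_mx j 0) (grad f) x) i 0.

(* Frechet sense: the library's norm on 'cV_N is the sup norm, which is
   equivalent to the Euclidean one. *)
Definition twice_differentiable (R : realType) (N : nat) (f : 'cV[R]_N -> R) :
  Prop := forall x, differentiable f x /\ differentiable (grad f) x.

Definition symmetric_edges (n : nat) (E : {set 'I_n * 'I_n}) : Prop :=
  forall i j, ((i, j) \in E) = ((j, i) \in E).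

Definition connected_network (n : nat) (E : {set 'I_n * 'I_n}) : Prop :=
  forall i j, connect [rel a b | (a, b) \in E] i j.

(* Dimension of a vector of [k] blocks of size [p], in the form expected by the
   library's block matrices; it equals [k * p]. *)
Notation bdim k p := (\sum_(i < k) p)%N.

(* The r = #|E| edges are numbered by [enum_val]. *)
Definition A_s (R : realType) (p n : nat) (E : {set 'I_n * 'I_n}) :
  'M[R]_(bdim #|E| p, bdim n p) :=
  \mxblock_(e < #|E|, i < n)
    (if (enum_val e).1 == i then 1%:M else 0 : 'M[R]_p).

Definition A_d (R : realType) (p n : nat) (E : {set 'I_n * 'I_n}) :
  'M[R]_(bdim #|E| p, bdim n p) :=
  \mxblock_(e < #|E|, i < n)
    (if (enum_val e).2 == i then 1%:M else 0 : 'M[R]_p).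

Definition A_mx (R : realType) (p n : nat) (E : {set 'I_n * 'I_n}) :
  'M[R]_(bdim #|E| p + bdim #|E| p, bdim n p) := col_mx (A_s R p E) (A_d R p E).

Definition B_mx (R : realType) (p n : nat) (E : {set 'I_n * 'I_n}) :
  'M[R]_(bdim #|E| p + bdim #|E| p, bdim #|E| p) := col_mx (- 1%:M) (- 1%:M).

Definition E_o (R : realType) (p n : nat) (E : {set 'I_n * 'I_n}) :
  'M[R]_(bdim #|E| p, bdim n p) := A_s R p E - A_d R p E.

Definition E_u (R : realType) (p n : nat) (E : {set 'I_n * 'I_n}) :
  'M[R]_(bdim #|E| p, bdim n p) := A_s R p E + A_d R p E.

Definition aggregate_cost (R : realType) (p n : nat)
  (fi : 'I_n -> 'cV[R]_p -> R) (x : 'cV[R]_(bdim n p)) : R :=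
  \sum_(i < n) fi i (submxcol x i).

Definition is_solution (R : realType) (N r s : nat) (f : 'cV[R]_N -> R)
  (A : 'M[R]_(s, N)) (B : 'M[R]_(s, r)) (xs : 'cV[R]_N) (zs : 'cV[R]_r) : Prop :=
  A *m xs + B *m zs = 0 /\
  forall (x : 'cV[R]_N) (z : 'cV[R]_r), A *m x + B *m z = 0 -> f xs <= f x.

Definition DQM (R : realType) (N r s : nat) (f : 'cV[R]_N -> R)
  (A : 'M[R]_(s, N)) (B : 'M[R]_(s, r)) (c : R)
  (x : nat -> 'cV[R]_N) (z : nat -> 'cV[R]_r) (lambda : nat -> 'cV[R]_s) : Prop :=
  forall k : nat,
  [/\ grad f (x k) + hessian f (x k) *m (x k.+1 - x k) + A^T *m lambda k
        + c *: (A^T *m (A *m x k.+1 + B *m z k)) = 0,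
      B^T *m lambda k + c *: (B^T *m (A *m x k.+1 + B *m z k.+1)) = 0
    & lambda k.+1 - lambda k - c *: (A *m x k.+1 + B *m z k.+1) = 0].

Definition C_mx (R : realType) (N : nat) (c : R) : 'M[R]_(N + N) :=
  block_mx c%:M 0 0 (c^-1)%:M.

Definition linear_to_zero (R : realType) (a : nat -> R) : Prop :=
  exists2 rho : R, 0 <= rho < 1 & forall k, 0 <= a k /\ a k.+1 <= rho * a k.

Definition R_linear_to_zero (R : realType) (a : nat -> R) : Prop :=
  exists2 b : nat -> R, linear_to_zero b & forall k, `|a k| <= b k.

(* Main.v *)
(* DQM is ADMM with the local costs replaced by their second-order models at the
   current point.  With the initialization, beta_k = - alpha_k and
   E_u x_k = 2 z_k for all k, so the recursion reduces to
     grad f(x_k) + H_k (x_{k+1} - x_k) + E_o^T alpha_{k+1}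
       + c E_u^T (z_{k+1} - z_k) = 0,
     alpha_{k+1} = alpha_k + (c / 2) E_o x_{k+1}.
   Write X = x_{k+1} - x*, d = x_{k+1} - x_k and
   e = grad f(x_{k+1}) - grad f(x_k) - H_k d.  Subtracting the stationarity
   condition at x* and taking the inner product with X shows that the energy ||u - u*||_C^2 drops by
     c ||z_{k+1} - z_k||^2 + ||alpha_{k+1} - alpha_k||^2 / c
       + <grad f(x_{k+1}) - grad f(x* ), X> - <X, e>,
   where the inner product of gradients is at least m ||X||^2, where
   c ||z_{k+1} - z_k||^2 >= (c gamma_u^2 / 4) ||d||^2, and where, by the mean
   value theorem, <X, e> <= (m / 2) ||X||^2 + (M^2 / (2 m)) ||d||^2.  By the
   condition on c the drop is at least (m / 2) (||d||^2 + ||X||^2).  In turn the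
   energy at k + 1 is at most a constant times ||d||^2 + ||X||^2, because E_o^T
   is injective on the column space of E_o; hence the energy contracts by a
   fixed factor, and it dominates ||x_k - x*||^2 because
   E_u (x_k - x* ) = 2 (z_k - z* ). *)

From HB Require Import structures.
Require Import Defs.
From mathcomp Require Import all_boot all_order all_algebra.
From mathcomp Require Import all_classical all_reals all_analysis.
From mathcomp Require Import ring lra.

Import Order.TTheory GRing.Theory Num.Theory.
Import numFieldNormedType.Exports.

Local Open Scope ring_scope.

Set Implicit Arguments.
Unset Strict Implicit.
Unset Printing Implicit Defensive.

(** * The Euclidean inner product *)

Definition dot (R : realType) (N : nat) (u v : 'cV[R]_N) : R := (u^T *m v) 0 0.

Section InnerProduct.
Variable R : realType.
Implicit Types N : nat.

Lemma dotE N (u v : 'cV[R]_N) : dot u v = \sum_i u i 0 * v i 0.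
Proof. by rewrite /dot mxE; apply: eq_bigr => i _; rewrite mxE. Qed.

Lemma dotC N (u v : 'cV[R]_N) : dot u v = dot v u.
Proof. by rewrite !dotE; apply: eq_bigr => i _; rewrite mulrC. Qed.

Lemma dotDr N (u v w : 'cV[R]_N) : dot u (v + w) = dot u v + dot u w.
Proof. by rewrite /dot mulmxDr mxE. Qed.

Lemma dotDl N (u v w : 'cV[R]_N) : dot (v + w) u = dot v u + dot w u.
Proof. by rewrite dotC dotDr !(dotC u). Qed.

Lemma dotZr N a (u v : 'cV[R]_N) : dot u (a *: v) = a * dot u v.
Proof. by rewrite /dot -scalemxAr mxE. Qed.

Lemma dotZl N a (u v : 'cV[R]_N) : dot (a *: v) u = a * dot v u.
Proof. by rewrite dotC dotZr dotC. Qed.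

Lemma dotNr N (u v : 'cV[R]_N) : dot u (- v) = - dot u v.
Proof. by rewrite -scaleN1r dotZr mulN1r. Qed.

Lemma dotNl N (u v : 'cV[R]_N) : dot (- v) u = - dot v u.
Proof. by rewrite dotC dotNr dotC. Qed.

Definition dot_linE := (dotDr, dotDl, dotNr, dotNl, dotZr, dotZl).

Lemma dot_mulmxl N K (A : 'M[R]_(N, K)) u v : dot (A *m u) v = dot u (A^T *m v).
Proof. by rewrite /dot trmx_mul mulmxA. Qed.

Lemma dot_ge0 N (v : 'cV[R]_N) : 0 <= dot v v.
Proof. by rewrite dotE sumr_ge0 // => i _; rewrite -expr2 sqr_ge0. Qed.

Lemma dot_eq0 N (v : 'cV[R]_N) : (dot v v == 0) = (v == 0).
Proof.
apply/eqP/eqP => [|->]; last by rewrite /dot mulmx0 mxE.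
rewrite dotE => h; apply/colP => i; rewrite mxE; apply/eqP.
rewrite -(orbb (_ == 0)) -mulf_eq0; apply/eqP.
by apply: (psumr_eq0P _ h) => // j _; rewrite -expr2 sqr_ge0.
Qed.

End InnerProduct.

(** * Gradients and Hessians *)

Section Calculus.
Variable R : realType.
Implicit Types N K : nat.

Lemma differentiable_mulmx N K (A : 'M[R]_(N, K)) (x : 'cV[R]_K) :
  differentiable (mulmx A : 'cV[R]_K -> 'cV[R]_N) x.
Proof.
have -> : (mulmx A : 'cV[R]_K -> 'cV[R]_N) =
    (\sum_(i < K) (fun v : 'cV[R]_K => v i 0 *: col i A)).
  apply/funext => v; rewrite fct_sumE; apply/colP => j.
  by rewrite summxE mxE; apply: eq_bigr => i _; rewrite !mxE mulrC.
apply: differentiable_sum => i.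
exact/differentiableZl/differentiable_coord.
Qed.

Lemma diff_mulmx N K (A : 'M[R]_(N, K)) (x v : 'cV[R]_K) :
  'd (mulmx A : 'cV[R]_K -> 'cV[R]_N) x v = A *m v.
Proof.
rewrite diff_lin // => y.
exact/differentiable_continuous/differentiable_mulmx.
Qed.

(** Linearity is registered so that [diff_lin] computes the differential of [dot w]. *)
HB.instance Definition _ N (w : 'cV[R]_N) :=
  GRing.isLinear.Build R 'cV[R]_N R *%R (dot w)
    (fun a u v => etrans (dotDr w (a *: u) v)
       (congr1 (+%R^~ (dot w v)) (dotZr a w u))).

Lemma differentiable_dot N (w x : 'cV[R]_N) : differentiable (dot w) x.
Proof.
have -> : dot w = (fun M : 'cV[R]_1 => M 0 0) \o mulmx w^T by [].
apply: differentiable_comp; first exact: differentiable_mulmx.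
exact: differentiable_coord.
Qed.

Lemma diff_dot N (w x v : 'cV[R]_N) : 'd (dot w) x v = dot w v.
Proof.
by rewrite diff_lin // => y; exact/differentiable_continuous/differentiable_dot.
Qed.

Lemma grad_diffE N (f : 'cV[R]_N -> R) x (g : 'cV[R]_N) : differentiable f x ->
  (forall v, 'd f x v = dot g v) -> grad f x = g.
Proof.
move=> df h; apply/colP => i; rewrite mxE deriveE // h dotE (bigD1 i) //= !mxE.
rewrite !eqxx mulr1 big1 ?addr0 // => j ji.
by rewrite mxE (negPf ji) mulr0.
Qed.

Lemma hessian_diffE N (f : 'cV[R]_N -> R) x (H : 'M[R]_N) :
  differentiable (grad f) x -> (forall v, 'd (grad f) x v = H *m v) ->
  hessian f x = H.
Proof.
move=> df h; apply/matrixP => i j; rewrite mxE deriveE // h.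
by rewrite -colE mxE.
Qed.

Lemma col_sum_delta N (v : 'cV[R]_N) : v = \sum_i v i 0 *: delta_mx i 0.
Proof.
by rewrite {1}(matrix_sum_delta v); apply: eq_bigr => i _; rewrite big_ord1.
Qed.

Lemma diff_grad N (f : 'cV[R]_N -> R) x v : differentiable f x ->
  'd f x v = dot (grad f x) v.
Proof.
move=> df; rewrite {1}(col_sum_delta v) linear_sum dotE.
by apply: eq_bigr => i _; rewrite linearZ /= mxE deriveE // mulrC.
Qed.

Lemma diff_hessian N (f : 'cV[R]_N -> R) x v : differentiable (grad f) x ->
  'd (grad f) x v = hessian f x *m v.
Proof.
move=> df; rewrite {1}(col_sum_delta v) linear_sum.
apply/colP => j; rewrite summxE mxE.
by apply: eq_bigr => i _; rewrite linearZ /= !mxE deriveE // mulrC.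
Qed.

Lemma grad_comp_mulmx N K (f : 'cV[R]_N -> R) (P : 'M[R]_(N, K)) x :
  differentiable f (P *m x) ->
  differentiable (f \o mulmx P) x /\
  grad (f \o mulmx P) x = P^T *m grad f (P *m x).
Proof.
move=> df; have dP := differentiable_mulmx P x.
have dfP : differentiable (f \o mulmx P) x by exact: differentiable_comp.
split=> //; apply: grad_diffE => // v.
rewrite diff_comp //= diff_grad // diff_mulmx.
by rewrite dot_mulmxl trmxK.
Qed.

(** Used with [P] extracting one block of coordinates. The gradient is itself a composition of
    [grad f] with two linear maps, so the chain rule applies a second time. *)
Lemma hessian_comp_mulmx N K (f : 'cV[R]_N -> R) (P : 'M[R]_(N, K)) :
  twice_differentiable f ->
  twice_differentiable (f \o mulmx P) /\
  forall x, hessian (f \o mulmx P) x = P^T *m hessian f (P *m x) *m P.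
Proof.
move=> df.
have gE : grad (f \o mulmx P) = mulmx P^T \o grad f \o mulmx P.
  apply/funext => x; rewrite (proj2 (grad_comp_mulmx _)) //.
  by case: (df (P *m x)).
have dP x := differentiable_mulmx P x.
have dPT x := differentiable_mulmx P^T x.
have dg x : differentiable (grad f \o mulmx P) x.
  by apply: differentiable_comp => //; case: (df (P *m x)).
have dgP x : differentiable (mulmx P^T \o (grad f \o mulmx P)) x.
  exact: differentiable_comp.
split=> x.
  split; last by rewrite gE; exact: dgP.
  by case: (@grad_comp_mulmx _ _ f P x) => //; case: (df (P *m x)).
apply: hessian_diffE => [|v]; rewrite gE; first exact: dgP.
have [_ dgx] := df (P *m x).
rewrite (@diff_comp _ _ _ _ (grad f \o mulmx P) (mulmx P^T)) //= diff_mulmx.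
by rewrite diff_comp //= diff_hessian // diff_mulmx !mulmxA.
Qed.

Lemma hessian_sum N n (f : 'I_n -> 'cV[R]_N -> R) :
  (forall i, twice_differentiable (f i)) ->
  twice_differentiable (\sum_i f i) /\
  forall x, hessian (\sum_i f i) x = \sum_i hessian (f i) x.
Proof.
move=> df.
have df1 i x : differentiable (f i) x by case: (df i x).
have df2 i x : differentiable (grad (f i)) x by case: (df i x).
have gE : grad (\sum_i f i) = \sum_i grad (f i).
  apply/funext => x; rewrite [in RHS]fct_sumE; apply/colP => j.
  rewrite mxE summxE.
  rewrite derive_sum; first by apply: eq_bigr => i _; rewrite mxE.
  by move=> i; exact: diff_derivable.
split=> x.
  by split; [|rewrite gE]; exact: differentiable_sum.
apply/matrixP => i j; rewrite mxE gE derive_sum.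
  by rewrite !summxE; apply: eq_bigr => k _; rewrite mxE.
by move=> k; exact: diff_derivable.
Qed.

(** The gradient is vector-valued, so the scalar mean value theorem is applied to its inner product
    with a fixed [w] along the segment from [x] to [y]; the point [xi] depends on [w]. *)
Lemma grad_mean_value N (f : 'cV[R]_N -> R) (x y w : 'cV[R]_N) :
  twice_differentiable f ->
  exists xi, dot w (grad f y - grad f x) = dot w (hessian f xi *m (y - x)).
Proof.
move=> df; set d := y - x.
pose l (s : R) : 'cV[R]_N := x + s *: d.
pose phi (s : R) : R := dot w (grad f (l s)).
have dphi (s : R) : is_derive s (1 : R) phi (dot w (hessian f (l s) *m d)).
  have dl : is_diff s l (fun h => h *: d).
    rewrite (_ : l = cst x + ( *:%R^~ d)); last exact/funext.
    apply: (@is_diff_eq _ _ _ _ _ _ _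
      (is_diffD (is_diff_cst x s) (is_diff_scalel s d))).
    by apply/funext => h; exact: add0r.
  have dfl : differentiable (grad f) (l s) by case: (df (l s)).
  have dgl : differentiable (grad f \o l) s by apply: differentiable_comp.
  have dw := differentiable_dot w (grad f (l s)).
  have dphi : differentiable phi s.
    exact: (@differentiable_comp _ _ _ _ (grad f \o l)).
  apply: DeriveDef; first exact: diff_derivable.
  rewrite deriveE // (@diff_comp _ _ _ _ (grad f \o l) (dot w)) //= diff_dot.
  by rewrite diff_comp //= diff_hessian // diff_val scale1r.
have [|s _] := @MVT R phi (fun s => dot w (hessian f (l s) *m d)) 0 1 ltr01
  (fun s _ => dphi s).
  apply: derivable_within_continuous => s _; exact: ex_derive.
rewrite subr0 mulr1 => h; exists (l s).
rewrite -h /phi /l scale1r scale0r addr0.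
by rewrite /d [x + _]addrC subrK dotDr dotNr.
Qed.

End Calculus.

(** * Quadratic forms *)

Section QuadraticForms.
Variable R : realType.
Implicit Types N K : nat.

Lemma dot_mulmxr N K (A : 'M[R]_(N, K)) u v : dot u (A *m v) = dot (A^T *m u) v.
Proof. by rewrite dotC dot_mulmxl dotC. Qed.

Lemma le_sqr_dot N (v : 'cV[R]_N) i : v i 0 ^+ 2 <= dot v v.
Proof.
rewrite dotE (bigD1 i) //= -expr2 lerDl sumr_ge0 // => j _.
by rewrite -expr2 sqr_ge0.
Qed.

Lemma quad_form_bounded N (S : 'M[R]_N) :
  exists2 b : R, 0 < b & forall v, dot v (S *m v) <= b * dot v v.
Proof.
have sge0 : 0 <= \sum_i \sum_j `|S i j|.
  by apply: sumr_ge0 => i _; apply: sumr_ge0.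
(* The added 1 keeps the constant positive when [S] is zero. *)
exists (1 + \sum_i \sum_j `|S i j|); first by rewrite ltr_wpDr.
move=> v.
apply: (@le_trans _ _ ((\sum_i \sum_j `|S i j|) * dot v v)); last first.
  by rewrite ler_wpM2r ?dot_ge0 // lerDr.
rewrite {1}dotE mulr_suml; apply: ler_sum => i _.
rewrite mxE mulr_sumr mulr_suml; apply: ler_sum => j _.
apply: le_trans (ler_norm _) _; rewrite mulrCA normrM.
apply: ler_wpM2l => //.
(* The squares of v_i - v_j and v_i + v_j give 2 |v_i v_j| <= v_i^2 + v_j^2 <= 2 |v|^2. *)
have := le_sqr_dot v i; have := le_sqr_dot v j.
rewrite ler_norml => hj hi.
have := sqr_ge0 (v i 0 - v j 0); have := sqr_ge0 (v i 0 + v j 0).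
rewrite !expr2 in hi hj *; move=> h1 h2.
by apply/andP; split; lra.
Qed.

Lemma mulmx_bounded N K (A : 'M[R]_(N, K)) :
  exists2 b : R, 0 < b & forall v, dot (A *m v) (A *m v) <= b * dot v v.
Proof.
have [b b0 h] := quad_form_bounded (A^T *m A); exists b => // v.
by rewrite dot_mulmxl mulmxA.
Qed.

(* [4 s <w, S v> = q(s v + w) - q(s v - w)] for the quadratic form [q] of [S] *)
Lemma sym_form_le N (S : 'M[R]_N) (k : R) : S^T = S ->
  (forall v, `|dot v (S *m v)| <= k * dot v v) ->
  forall (s : R) v w, 0 < s ->
    dot w (S *m v) <= k / 2 * (s * dot v v + s^-1 * dot w w).
Proof.
move=> symS hS s v w s0.
have := hS (s *: v + w); have := hS (s *: v - w).
rewrite !ler_norml => /andP[+ _] /andP[_].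
rewrite !mulmxDr !mulmxN -!scalemxAr !dot_linE (dotC w v).
rewrite (_ : dot v (S *m w) = dot w (S *m v)); last first.
  by rewrite dot_mulmxr symS dotC.
move=> h1 h2.
rewrite -(ler_pM2l s0) [leRHS]mulrCA mulrDr !mulrA mulfV ?gt_eqF // mul1r.
lra.
Qed.

(** Young's inequality for the semi-inner product of [S]: expand the form at [s *: v - w], which is
    nonnegative, and divide by 2s. *)
Lemma psd_form_le N (S : 'M[R]_N) (s : R) v w : psd S -> 0 < s ->
  dot w (S *m v) <= 2^-1 * (s * dot v (S *m v) + s^-1 * dot w (S *m w)).
Proof.
move=> [symS hS] s0.
have := hS (s *: v - w); rewrite -mulmxA -/(dot _ _).
rewrite !mulmxDr !mulmxN -!scalemxAr !dot_linE.
rewrite (_ : dot v (S *m w) = dot w (S *m v)); last first.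
  by rewrite dot_mulmxr symS dotC.
move=> h1.
rewrite -(ler_pM2l s0) [leRHS]mulrCA mulrDr !mulrA mulfV ?gt_eqF // mul1r.
lra.
Qed.

(** Applying [invmx S] to S v gives |v|^2 <= b |S v|^2. Young's inequality with w = S v and s = k
    leaves half of |S v|^2 on the right, whence |S v|^2 <= k <v, S v>. *)
Lemma psd_unit_coercive N (S : 'M[R]_N) : psd S -> S \in unitmx ->
  exists2 e : R, 0 < e & forall v, e * dot v v <= dot v (S *m v).
Proof.
move=> psdS uS.
have [b b0 hb] := mulmx_bounded (invmx S).
have [k k0 hk] := quad_form_bounded S.
exists (b * k)^-1; first by rewrite invr_gt0 mulr_gt0.
move=> v; rewrite -(ler_pM2l (mulr_gt0 b0 k0)) mulrA mulfV ?mul1r; last first.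
  by rewrite gt_eqF ?mulr_gt0.
have := hb (S *m v); rewrite mulmxA mulVmx // mul1mx => /le_trans; apply.
rewrite -mulrA ler_pM2l //.
have := psd_form_le v (S *m v) psdS k0.
have : k^-1 * dot (S *m v) (S *m (S *m v)) <= dot (S *m v) (S *m v).
  by rewrite ler_pdivrMl.
lra.
Qed.

(* The supremum [t] of the [a] with [a I <= S] is an eigenvalue: were [S - t I]
   invertible, it would dominate some [e I] with [e > 0]. *)
Lemma psd_min_eigenvalue N (S : 'M[R]_N) (v0 : 'cV[R]_N) : psd S -> v0 != 0 ->
  exists t, [/\ 0 <= t, eigenvalue S t
    & forall v, t * dot v v <= dot v (S *m v)].
Proof.
move=> [symS hS] v0N0.
have pos v : v != 0 -> 0 < dot v v by rewrite lt_def dot_eq0 dot_ge0 andbT.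
pose A := [set a : R | forall v, a * dot v v <= dot v (S *m v)]%classic.
have A0 : A 0 by move=> v; rewrite mul0r /dot mulmxA.
have ubA v : v != 0 -> ubound A (dot v (S *m v) / dot v v).
  by move=> vN0 a /(_ v); rewrite ler_pdivlMr ?pos.
have supA : has_sup A by split; [exists 0|eexists; exact: ubA v0N0].
have t0 : 0 <= sup A by exact: (sup_upper_bound supA).
have At v : sup A * dot v v <= dot v (S *m v).
  have [->|vN0] := eqVneq v 0; first by rewrite mulmx0 /dot mulmx0 mxE mulr0.
  by rewrite -ler_pdivlMr ?pos //; apply: ge_sup; [exists 0|exact: ubA].
exists (sup A); split => //; apply: contraT.
rewrite negbK kermx_eq0 row_free_unit => uS.
have [|e e0 he] := psd_unit_coercive _ uS.
  split; first by rewrite linearB /= symS tr_scalar_mx.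
  move=> v; rewrite -mulmxA -/(dot _ _) mulmxBl mul_scalar_mx dotDr dotNr dotZr.
  by rewrite subr_ge0.
suff /(ub_le_sup supA.2) : A (sup A + e) by rewrite gerDl leNgt e0.
move=> v; have := he v; rewrite mulmxBl mul_scalar_mx dotDr dotNr dotZr; lra.
Qed.

End QuadraticForms.

(** * Lower bounds from singular values and Gram matrices *)

Section SingularValues.
Variable R : realType.
Implicit Types N K : nat.

(** The least eigenvalue t of [A^T *m A] bounds its form from below, and sqrt t is a singular value,
    so g^2 <= t. The case v = 0 is split off because an eigenvalue exists only in positive
    dimension. *)
Lemma mulmx_singular_lower_bound N K (A : 'M[R]_(N, K)) (g : R) : 0 < g ->
  (forall s, singular_value A s -> g <= s) ->
  forall v, g ^+ 2 * dot v v <= dot (A *m v) (A *m v).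
Proof.
move=> g0 hA v; have [->|vN0] := eqVneq v 0.
  by rewrite mulmx0 /dot !mulmx0 !mxE mulr0.
have psdA : psd (A^T *m A).
  split; first by rewrite trmx_mul trmxK.
  by move=> u; rewrite mulmxA -trmx_mul -mulmxA -/(dot _ _) dot_ge0.
have [t [t0 et ht]] := psd_min_eigenvalue psdA vN0.
rewrite dot_mulmxl mulmxA; apply: le_trans (ht v).
apply: ler_wpM2r; first exact: dot_ge0.
rewrite -(sqr_sqrtr t0) ler_pXn2r ?nnegrE ?sqrtr_ge0 ?(ltW g0) //.
by apply: hA; split; rewrite ?sqrtr_ge0 ?sqr_sqrtr.
Qed.

(* [A] and [A^T A] have the same kernel. *)
Lemma submx_gram N K (A : 'M[R]_(N, K)) : (A <= A^T *m A)%MS.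
Proof.
rewrite submxE; set C := cokermx _.
have AC0 : (A *m C)^T *m (A *m C) = 0.
  by rewrite trmx_mul -mulmxA (mulmxA A^T) mulmx_coker mulmx0.
apply/eqP/matrixP => i j.
have : dot (col j (A *m C)) (col j (A *m C)) == 0.
  rewrite /dot tr_col -row_mul mxE.
  have /matrixP/(_ j j) := AC0; rewrite !mxE => {2}<-.
  by apply/eqP/eq_bigr => k _; rewrite !mxE.
by rewrite dot_eq0 => /eqP/colP/(_ i); rewrite !mxE.
Qed.

(** Writing A = D A^T A makes D a left inverse of A^T on the column space of A; the constant is a
    bound for D. *)
Lemma colspace_trmx_coercive N K (A : 'M[R]_(N, K)) :
  exists2 b : R, 0 < b &
    forall v, in_colspace A v -> dot v v <= b * dot (A^T *m v) (A^T *m v).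
Proof.
have /submxP[D AE] := submx_gram A.
have [b b0 hb] := mulmx_bounded D; exists b => // v [w vE].
have vD : D *m (A^T *m v) = v by rewrite vE !mulmxA -(mulmxA D) -AE.
by have := hb (A^T *m v); rewrite vD.
Qed.

End SingularValues.

(** * Gradient estimates from two-sided Hessian bounds *)

Lemma form_sub_bounded (R : realType) N (S T : 'M[R]_N) (v : 'cV[R]_N)
    (m M : R) :
  0 <= m * dot v v ->
  m * dot v v <= dot v (S *m v) -> dot v (S *m v) <= M * dot v v ->
  m * dot v v <= dot v (T *m v) -> dot v (T *m v) <= M * dot v v ->
  `|dot v ((S - T) *m v)| <= M * dot v v.
Proof.
rewrite mulmxBl dotDr dotNr ler_norml.
by move=> *; apply/andP; split; lra.
Qed.

Section BoundedHessian.
Variables (R : realType) (N : nat) (f : 'cV[R]_N -> R) (m M : R).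
Hypotheses (hm : 0 < m) (hmM : m <= M).
Hypothesis hf : twice_differentiable f.
Hypothesis hlo : forall x, loewner_le m%:M (hessian f x).
Hypothesis hup : forall x, loewner_le (hessian f x) M%:M.

Let M0 : 0 < M. Proof. exact: lt_le_trans hmM. Qed.

(** Symmetry comes from the Loewner bound, since [psd] includes it, rather than from equality of
    mixed derivatives. *)
Lemma hessian_sym x : (hessian f x)^T = hessian f x.
Proof.
have [+ _] := hlo x; rewrite linearB /= tr_scalar_mx.
by move/(congr1 (+%R^~ m%:M)); rewrite !subrK.
Qed.

Lemma hessian_ge x v : m * dot v v <= dot v (hessian f x *m v).
Proof.
have [_ /(_ v)] := hlo x; rewrite -mulmxA -/(dot _ _) mulmxBl mul_scalar_mx.
by rewrite !dot_linE subr_ge0.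
Qed.

Lemma hessian_le x v : dot v (hessian f x *m v) <= M * dot v v.
Proof.
have [_ /(_ v)] := hup x; rewrite -mulmxA -/(dot _ _) mulmxBl mul_scalar_mx.
by rewrite !dot_linE subr_ge0.
Qed.

Lemma grad_strongly_monotone x y :
  m * dot (y - x) (y - x) <= dot (y - x) (grad f y - grad f x).
Proof.
by have [xi ->] := grad_mean_value x y (y - x) hf; exact: hessian_ge.
Qed.

Lemma grad_increment_form_le x y w s : 0 < s ->
  dot w (grad f y - grad f x) <=
    M / 2 * (s * dot (y - x) (y - x) + s^-1 * dot w w).
Proof.
move=> s0; have [xi ->] := grad_mean_value x y w hf.
apply: sym_form_le => // [|v]; first exact: hessian_sym.
rewrite ger0_norm ?hessian_le //; apply: le_trans (hessian_ge _ _).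
by rewrite mulr_ge0 ?dot_ge0 ?ltW.
Qed.

(** The left side is <w, (H(xi) - H(x)) (y - x)>. Both Hessian forms take values in [0, M |v|^2], so
    their difference is at most M |v|^2 in absolute value and [sym_form_le] applies. *)
Lemma quadratic_model_form_le x y w s : 0 < s ->
  dot w (grad f y - grad f x - hessian f x *m (y - x)) <=
    M / 2 * (s * dot (y - x) (y - x) + s^-1 * dot w w).
Proof.
move=> s0; have [xi xiE] := grad_mean_value x y w hf.
rewrite dotDr xiE -dotDr -mulmxBl.
apply: sym_form_le s0 => [|v].
  apply/matrixP => i j.
  by rewrite -[in RHS](hessian_sym x) -[in RHS](hessian_sym xi) !mxE.
have mv0 : 0 <= m * dot v v by rewrite mulr_ge0 ?dot_ge0 ?ltW.
by apply: form_sub_bounded mv0 _ _ _ _;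
  [exact: hessian_ge|exact: hessian_le|exact: hessian_ge|exact: hessian_le].
Qed.

(** Turns a family of tested bounds into a norm bound: with w = y and s = M the last term is half of
    |y|^2 and is absorbed on the left. *)
Lemma sqr_le_form (y : 'cV[R]_N) D :
  (forall w s, 0 < s -> dot w y <= M / 2 * (s * D + s^-1 * dot w w)) ->
  dot y y <= M ^+ 2 * D.
Proof.
move=> /(_ y M M0).
have -> : M / 2 * (M * D + M^-1 * dot y y) = (M ^+ 2 * D + dot y y) / 2.
  by field; rewrite gt_eqF.
lra.
Qed.

End BoundedHessian.

(** * Contraction of the energy *)

(** The two sides differ by the sum of the squared norms of the pairwise differences. *)
Lemma sqr_add3_le (R : realType) N (u v w : 'cV[R]_N) :
  dot (u + v + w) (u + v + w) <= 3 * (dot u u + dot v v + dot w w).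
Proof.
have := dot_ge0 (u - v); have := dot_ge0 (v - w); have := dot_ge0 (u - w).
rewrite !dot_linE (dotC v u) (dotC w u) (dotC w v); lra.
Qed.

Lemma sqr_dotB (R : realType) N (u v : 'cV[R]_N) :
  dot (u - v) (u - v) = dot u u - 2 * dot u v + dot v v.
Proof. rewrite !dot_linE (dotC v u); ring. Qed.

Lemma stationarity_diff (R : realType) N (gx gx' gs h a b w : 'cV[R]_N) :
  gx + h + a + w = 0 -> gs + b = 0 ->
  gx' - gs + (a - b) + w = gx' - gx - h.
Proof.
move=> /colP hx /colP hs; apply/colP => i.
by have := hx i; have := hs i; rewrite !mxE; lra.
Qed.

(** With X = x' - xs and d = x' - x: [dd], [XX] are their squared norms; [ZZ], [Zz], [zz] are the
    products of z' - zs and z' - z, and [AA], [Aa], [aa] those for alpha; [XG] and [Xe] pair X with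
    the gradient difference and with the model error. The weight M / m leaves [Xe] only half of the
    strong monotonicity m |X|^2. *)
Lemma descent_arith (R : realType) (m M c g : R)
    (dd XX ZZ Zz zz AA Aa aa XG Xe : R) :
  0 < m -> m <= M -> 0 < c -> 0 < g -> 4 * M ^+ 2 / (m * g ^+ 2) < c ->
  0 <= dd -> 0 <= aa ->
  XG + 2 / c * Aa + 2 * c * Zz = Xe -> m * XX <= XG ->
  Xe <= M / 2 * (M / m * dd + (M / m)^-1 * XX) ->
  g ^+ 2 * dd <= 4 * zz ->
  c * ZZ + c^-1 * AA + m / 2 * (dd + XX)
    <= c * (ZZ - 2 * Zz + zz) + c^-1 * (AA - 2 * Aa + aa).
Proof.
move=> m0 mM c0 g0 hcbig dd0 aa0 inner mono eM hd.
have M0 : 0 < M by exact: lt_le_trans mM.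
(* The condition on c gives c |z' - z|^2 >= (M^2 / m) |d|^2, twice what the model error costs. *)
have cd : 4 * (M ^+ 2 / m * dd) <= 4 * (c * zz).
  apply: (@le_trans _ _ (c * (g ^+ 2 * dd))); last first.
    by rewrite [leRHS]mulrCA ler_pM2l.
  rewrite (mulrA 4) (mulrA c) ler_wpM2r // ltW // -ltr_pdivrMr ?exprn_gt0 //.
  by rewrite -mulrA -mulrA -invfM mulrA.
(* The remaining half of (M^2 / m) |d|^2 is at least (m / 2) |d|^2. *)
have mM2 : m * dd <= M ^+ 2 / m * dd.
  rewrite ler_wpM2r // ler_pdivlMr // -expr2.
  by rewrite ler_pXn2r // nnegrE ltW.
have aage0 : 0 <= c^-1 * aa by rewrite mulr_ge0 // invr_ge0 ltW.
have e1 : M / 2 * (M / m * dd + (M / m)^-1 * XX)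
   = M ^+ 2 / m * dd / 2 + m / 2 * XX by field; rewrite !gt_eqF.
have e2 : 2 / c * Aa = 2 * (c^-1 * Aa) by rewrite mulrA.
rewrite e1 in eM; rewrite e2 in inner.
lra.
Qed.

(** Here [GG] and [ee] are the squared norms of the gradient difference to [xs] and of the model
    error, and [zz] is that of Eu^T (z' - z); [q] is the coercivity constant of Eo^T on the column
    space of Eo. *)
Lemma energy_bound_arith (R : realType) (M c b b' q dd XX ZZ AA GG ee zz : R) :
  0 < c -> 0 < b -> 0 < b' -> 0 < q -> 0 <= dd -> 0 <= XX ->
  GG <= M ^+ 2 * XX -> ee <= M ^+ 2 * dd -> zz <= b' * dd -> ZZ <= b * XX ->
  AA <= q * (3 * (GG + ee + c ^+ 2 * zz)) ->
  c * ZZ + c^-1 * AA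
    <= (c * b + c^-1 * q * (3 * (M ^+ 2 + c ^+ 2 * b'))) * (dd + XX).
Proof.
move=> c0 b0 b'0 q0 dd0 XX0 hG he hz hZ hA.
rewrite mulrDl; apply: lerD.
  rewrite -mulrA ler_pM2l //; apply: le_trans hZ _; rewrite ler_pM2l //; lra.
have -> : c^-1 * q * (3 * (M ^+ 2 + c ^+ 2 * b')) * (dd + XX) =
  c^-1 * (q * (3 * ((M ^+ 2 + c ^+ 2 * b') * (dd + XX)))) by rewrite !mulrA.
rewrite ler_pM2l ?invr_gt0 //; apply: le_trans hA _.
rewrite ler_pM2l // ler_pM2l //.
have : c ^+ 2 * zz <= c ^+ 2 * (b' * dd) by rewrite ler_pM2l ?exprn_gt0.
have : 0 <= c ^+ 2 * (b' * XX) by rewrite !mulr_ge0 // ltW.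
have -> : (M ^+ 2 + c ^+ 2 * b') * (dd + XX) =
  M ^+ 2 * dd + M ^+ 2 * XX + (c ^+ 2 * (b' * dd) + c ^+ 2 * (b' * XX)) by ring.
lra.
Qed.

Section Contraction.
Variables (R : realType) (N r : nat) (f : 'cV[R]_N -> R) (m M g c : R).
Variables (Eo Eu : 'M[R]_(r, N)) (xs : 'cV[R]_N) (zs als : 'cV[R]_r).
Hypotheses (hm : 0 < m) (hmM : m <= M) (hc : 0 < c) (hg : 0 < g).
Hypothesis hf : twice_differentiable f.
Hypothesis hlo : forall x, loewner_le m%:M (hessian f x).
Hypothesis hup : forall x, loewner_le (hessian f x) M%:M.
Hypothesis hEu : forall v, g ^+ 2 * dot v v <= dot (Eu *m v) (Eu *m v).
Hypothesis hcbig : 4 * M ^+ 2 / (m * g ^+ 2) < c.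
Hypothesis hzs : Eu *m xs = 2 *: zs.
Hypothesis hxs : Eo *m xs = 0.
Hypothesis hals : in_colspace Eo als.
Hypothesis hkkt : grad f xs + Eo^T *m als = 0.

Let energy (z al : 'cV[R]_r) : R :=
  c * dot (z - zs) (z - zs) + c^-1 * dot (al - als) (al - als).

(** The reduced recursion as a relation between consecutive states, carrying along the invariants
    that the energy estimates need. *)
Definition dqm_step (x : 'cV[R]_N) (z al : 'cV[R]_r)
    (x' : 'cV[R]_N) (z' al' : 'cV[R]_r) : Prop :=
  [/\ Eu *m x = 2 *: z, Eu *m x' = 2 *: z', in_colspace Eo al',
      al' = al + (c / 2) *: (Eo *m x')
    & grad f x + hessian f x *m (x' - x) + Eo^T *m al'
        + c *: (Eu^T *m (z' - z)) = 0].

Let M0 : 0 < M. Proof. exact: lt_le_trans hmM. Qed.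

Lemma dqm_step_diff x z al x' z' al' : dqm_step x z al x' z' al' ->
  [/\ Eu *m (x' - xs) = 2 *: (z' - zs), Eu *m (x' - x) = 2 *: (z' - z),
      Eo *m (x' - xs) = (2 / c) *: (al' - al)
    & grad f x' - grad f xs + Eo^T *m (al' - als) + c *: (Eu^T *m (z' - z))
        = grad f x' - grad f x - hessian f x *m (x' - x)].
Proof.
move=> [zE z'E _ al'E stat]; split.
- by rewrite mulmxBr z'E hzs -scalerBr.
- by rewrite mulmxBr z'E zE -scalerBr.
- rewrite mulmxBr hxs subr0 al'E [al + _]addrC addrK scalerA.
  by rewrite (_ : _ * _ = 1) ?scale1r //; field; rewrite gt_eqF.
- by rewrite mulmxBr; exact: stationarity_diff.
Qed.

Lemma dqm_descent x z al x' z' al' : dqm_step x z al x' z' al' ->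
  energy z' al' + m / 2 * (dot (x' - x) (x' - x) + dot (x' - xs) (x' - xs))
    <= energy z al.
Proof.
move=> st; have [EuX Eud EoX stat] := dqm_step_diff st.
rewrite /energy (_ : z - zs = (z' - zs) - (z' - z)); last first.
  by rewrite opprB [RHS]addrC subrKA.
rewrite (_ : al - als = (al' - als) - (al' - al)); last first.
  by rewrite opprB [RHS]addrC subrKA.
rewrite (sqr_dotB (z' - zs)) (sqr_dotB (al' - als)).
apply: (descent_arith _ _ hm hmM hc hg hcbig).
- exact: dot_ge0.
- exact: dot_ge0.
- apply: etrans (congr1 (dot (x' - xs)) stat).
  rewrite [dot _ (_ + c *: _)]dotDr [dot _ (_ + Eo^T *m _)]dotDr dotZr.
  rewrite 2!dot_mulmxr !trmxK EoX EuX !dotZl (dotC (al' - al)).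
  by rewrite [c * (2 * _)]mulrCA (mulrA 2).
- exact: (grad_strongly_monotone hf hlo).
- by apply: (quadratic_model_form_le hm hf hlo hup); rewrite !divr_gt0.
- by apply: le_trans (hEu _) _; rewrite Eud dotZl dotZr mulrA; lra.
Qed.

Lemma dqm_energy_bound : exists2 C : R, 0 < C &
  forall x z al x' z' al', dqm_step x z al x' z' al' ->
  energy z' al' <= C * (dot (x' - x) (x' - x) + dot (x' - xs) (x' - xs)).
Proof.
have [b b0 hb] := mulmx_bounded Eu.
(* The Gram matrix enters because Eu^T Eu (x' - x) = 2 Eu^T (z' - z). *)
have [b' b'0 hb'] := mulmx_bounded (Eu^T *m Eu).
have [q q0 hq] := colspace_trmx_coercive Eo.
exists (c * b + c^-1 * q * (3 * (M ^+ 2 + c ^+ 2 * b'))).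
  rewrite addr_gt0 ?mulr_gt0 ?addr_gt0 ?invr_gt0 ?exprn_gt0 //.
  by rewrite mulr_gt0 ?exprn_gt0.
move=> x z al x' z' al' st; have [EuX Eud _ stat] := dqm_step_diff st.
have [_ _ [w' al'C] _ _] := st.
apply: (@energy_bound_arith _ _ _ _ _ _ _ _ _ _
  (dot (grad f x' - grad f xs) (grad f x' - grad f xs))
  (dot (grad f x' - grad f x - hessian f x *m (x' - x))
       (grad f x' - grad f x - hessian f x *m (x' - x)))
  (dot (Eu^T *m (z' - z)) (Eu^T *m (z' - z)))) => //.
- exact: dot_ge0.
- exact: dot_ge0.
- apply: (sqr_le_form hm hmM) => w s s0.
  exact: (grad_increment_form_le hm hf hlo hup).
- apply: (sqr_le_form hm hmM) => w s s0.
  exact: (quadratic_model_form_le hm hf hlo hup).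
- have := hb' (x' - x); rewrite -mulmxA Eud -scalemxAr dotZl dotZr.
  have := dot_ge0 (Eu^T *m (z' - z)); lra.
- have := hb (x' - xs); rewrite EuX dotZl dotZr.
  have := dot_ge0 (z' - zs); lra.
have AC : in_colspace Eo (al' - als).
  by have [w alsE] := hals; exists (w' - w); rewrite mulmxBr -al'C -alsE.
apply: le_trans (hq _ AC) _; rewrite ler_pM2l //.
(* The stationarity difference is solved for the dual error, which splits into three terms already
   bounded. *)
rewrite (_ : Eo^T *m (al' - als) =
  - (grad f x' - grad f xs) + (grad f x' - grad f x - hessian f x *m (x' - x))
  + - (c *: (Eu^T *m (z' - z)))).
  apply: le_trans (sqr_add3_le _ _ _) _.
  by rewrite 2!dotNl 2!dotNr !opprK dotZl dotZr [c * (c * _)]mulrA -expr2.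
by rewrite -stat addrA addrA addNr add0r addrK.
Qed.

Lemma dqm_contraction : exists2 rho : R, 0 <= rho < 1 &
  forall x z al x' z' al', dqm_step x z al x' z' al' ->
  energy z' al' <= rho * energy z al.
Proof.
have [C C0 hC] := dqm_energy_bound.
have del0 : 0 < m / 2 / C by rewrite !divr_gt0.
(* Descent and the energy bound together give (1 + m / (2 C)) energy' <= energy. *)
exists (1 + m / 2 / C)^-1.
  by rewrite invr_ge0 invf_lt1 ?addr_gt0 // ltrDl del0 addr_ge0 // ltW.
move=> x z al x' z' al' st; rewrite mulrC ler_pdivlMr ?addr_gt0 //.
have h : m / 2 / C * energy z' al'
    <= m / 2 * (dot (x' - x) (x' - x) + dot (x' - xs) (x' - xs)).
  rewrite -[m / 2 / C * _]mulrA ler_pM2l ?divr_gt0 // ler_pdivrMl //.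
  exact: hC st.
rewrite mulrDr mulr1 [energy z' al' * _]mulrC; have := dqm_descent st; lra.
Qed.

End Contraction.

(** * The network problem *)

Section Aggregate.
Variable R : realType.

Lemma psd_congruence N K (A : 'M[R]_N) (P : 'M[R]_(N, K)) :
  psd A -> psd (P^T *m A *m P).
Proof.
move=> [symA hA]; split; first by rewrite !trmx_mul trmxK symA mulmxA.
move=> v; have := hA (P *m v); rewrite trmx_mul.
by rewrite !mulmxA.
Qed.

Lemma psd_sum N (I : finType) (A : I -> 'M[R]_N) :
  (forall i, psd (A i)) -> psd (\sum_i A i).
Proof.
move=> hA; split.
  by rewrite linear_sum; apply: eq_bigr => i _; case: (hA i).
move=> v; rewrite mulmx_sumr mulmx_suml summxE.
by apply: sumr_ge0 => i _; case: (hA i).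
Qed.

Variables (p n : nat).

(** Taking a block row of the identity makes block extraction a matrix product, so that the chain
    rule for [mulmx] applies. *)
Definition block_proj (i : 'I_n) : 'M[R]_(p, bdim n p) := submxcol 1%:M i.

Lemma block_proj_mul i (x : 'cV[R]_(bdim n p)) :
  block_proj i *m x = submxcol x i.
Proof. by rewrite submxcol_mul mul1mx. Qed.

(** Stacked vertically, the projections form the identity matrix, and the sum is its Gram matrix. *)
Lemma sum_block_proj_gram : \sum_i (block_proj i)^T *m block_proj i = 1%:M.
Proof.
rewrite -mul_mxrow_mxcol submxcolK -[X in X *m _]trmxK tr_mxrow.
under eq_mxcol do rewrite trmxK.
by rewrite submxcolK trmx1 mulmx1.
Qed.

Lemma scalar_mx_blocks a :
  a%:M = \sum_i (block_proj i)^T *m a%:M *m block_proj i.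
Proof.
rewrite -scalemx1 -sum_block_proj_gram scaler_sumr; apply: eq_bigr => i _.
by rewrite mul_mx_scalar scalemxAl.
Qed.

Variable fi : 'I_n -> 'cV[R]_p -> R.
Hypothesis hfi : forall i, twice_differentiable (fi i).

Lemma aggregate_costE :
  aggregate_cost fi = \sum_i (fi i \o mulmx (block_proj i)).
Proof.
apply/funext => x; rewrite fct_sumE; apply: eq_bigr => i _ /=.
by rewrite block_proj_mul.
Qed.

Lemma aggregate_twice_differentiable :
  twice_differentiable (aggregate_cost fi).
Proof.
rewrite aggregate_costE; apply: (proj1 (hessian_sum _)) => i.
by case: (hessian_comp_mulmx (block_proj i) (hfi i)).
Qed.

Lemma aggregate_hessianE x : hessian (aggregate_cost fi) x =
  \sum_i (block_proj i)^T *m hessian (fi i) (block_proj i *m x) *m block_proj i.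
Proof.
rewrite aggregate_costE (proj2 (hessian_sum _)) => [|i].
  by apply: eq_bigr => i _; case: (hessian_comp_mulmx (block_proj i) (hfi i)).
by case: (hessian_comp_mulmx (block_proj i) (hfi i)).
Qed.

(** Splitting m I over the blocks writes the gap as a sum of congruences P_i^T (H_i - m I) P_i of
    psd matrices. *)
Lemma aggregate_hessian_ge m x :
  (forall i y, loewner_le m%:M (hessian (fi i) y)) ->
  loewner_le m%:M (hessian (aggregate_cost fi) x).
Proof.
move=> h; rewrite aggregate_hessianE /loewner_le scalar_mx_blocks -sumrB.
apply: psd_sum => i; rewrite -mulmxBl -mulmxBr.
exact/psd_congruence/h.
Qed.

Lemma aggregate_hessian_le M x :
  (forall i y, loewner_le (hessian (fi i) y) M%:M) ->
  loewner_le (hessian (aggregate_cost fi) x) M%:M.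
Proof.
move=> h; rewrite aggregate_hessianE /loewner_le scalar_mx_blocks -sumrB.
apply: psd_sum => i; rewrite -mulmxBl -mulmxBr.
exact/psd_congruence/h.
Qed.

End Aggregate.

(** * Reduction of DQM to the oriented and unoriented incidence matrices *)

Section Recursion.
Variables (R : realType) (N r : nat).
Variables (As Ad : 'M[R]_(r, N)).

Let A := col_mx As Ad.
Let B : 'M[R]_(r + r, r) := col_mx (- 1%:M) (- 1%:M).

Lemma residualE (x : 'cV[R]_N) (z : 'cV[R]_r) :
  A *m x + B *m z = col_mx (As *m x - z) (Ad *m x - z).
Proof. by rewrite !mul_col_mx add_col_mx mulNmx mul1mx. Qed.

Lemma trmx_B_mul (a b : 'cV[R]_r) : B^T *m col_mx a b = - (a + b).
Proof.
by rewrite tr_col_mx mul_row_col linearN /= trmx1 !mulNmx !mul1mx opprD.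
Qed.

Lemma trmx_A_mul (a b : 'cV[R]_r) :
  A^T *m col_mx a b = As^T *m a + Ad^T *m b.
Proof. by rewrite tr_col_mx mul_row_col. Qed.

Lemma trmx_A_mul_antisym (a : 'cV[R]_r) :
  A^T *m col_mx a (- a) = (As - Ad)^T *m a.
Proof. by rewrite trmx_A_mul mulmxN -mulmxBl -raddfB. Qed.

Lemma feasibleE (x : 'cV[R]_N) (z : 'cV[R]_r) : A *m x + B *m z = 0 ->
  (As + Ad) *m x = 2 *: z /\ (As - Ad) *m x = 0.
Proof.
rewrite residualE -col_mx0 => /eq_col_mx[/eqP + /eqP].
rewrite !subr_eq0 => /eqP hs /eqP hd.
by rewrite mulmxDl mulmxBl hs hd subrr scaler_nat mulr2n.
Qed.

Variables (f : 'cV[R]_N -> R) (c : R).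
Variables (x : nat -> 'cV[R]_N) (z alpha beta : nat -> 'cV[R]_r).
Hypothesis hc : 0 < c.
Hypothesis hDQM : DQM f A B c x z (fun k => col_mx (alpha k) (beta k)).
Hypothesis hdual : alpha 0%N = - beta 0%N.
Hypothesis hprimal : (As + Ad) *m x 0%N = 2 *: z 0%N.
Hypothesis hcol : in_colspace (As - Ad) (alpha 0%N).

Lemma dqm_dual_update k :
  alpha k.+1 = alpha k + c *: (As *m x k.+1 - z k.+1) /\
  beta k.+1 = beta k + c *: (Ad *m x k.+1 - z k.+1).
Proof.
have [_ _] := hDQM k; rewrite residualE scale_col_mx !opp_col_mx !add_col_mx.
rewrite -col_mx0 => /eq_col_mx[/eqP + /eqP].
by rewrite !subr_eq0 !subr_eq => /eqP -> /eqP ->; rewrite ![_ + c *: _]addrC.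
Qed.

(** For positive indices, the second and third equations combine into B^T lambda_{k+1} = 0, that is
    alpha + beta = 0; index 0 is the initialization. *)
Lemma dqm_dual_antisym k : beta k = - alpha k.
Proof.
case: k => [|k]; first by rewrite hdual opprK.
have [_ + h3] := hDQM k; have /eqP := h3.
rewrite subr_eq0 subr_eq => /eqP h.
rewrite scalemxAr -mulmxDr [col_mx (alpha k) _ + _]addrC -h trmx_B_mul.
by move/eqP; rewrite oppr_eq0 addrC addr_eq0 => /eqP.
Qed.

(** Since alpha + beta vanishes before and after a step, the two dual increments, c times the
    residual blocks, sum to zero. *)
Lemma dqm_primal k : (As + Ad) *m x k = 2 *: z k.
Proof.
case: k => [//|k]; have [ha hb] := dqm_dual_update k.
have : c *: ((As *m x k.+1 - z k.+1) + (Ad *m x k.+1 - z k.+1)) = 0.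
  have := dqm_dual_antisym k.+1.
  rewrite ha hb dqm_dual_antisym opprD => /addrI h.
  by rewrite scalerDr h subrr.
move/eqP; rewrite scaler_eq0 gt_eqF //= addrACA -mulmxDl -opprD subr_eq0.
by move=> /eqP ->; rewrite scaler_nat mulr2n.
Qed.

Lemma dqm_alpha_update k :
  alpha k.+1 = alpha k + (c / 2) *: ((As - Ad) *m x k.+1).
Proof.
have [-> _] := dqm_dual_update k; congr (_ + _).
have -> : z k.+1 = 2^-1 *: ((As + Ad) *m x k.+1).
  by rewrite dqm_primal scalerA mulVf ?scale1r // pnatr_eq0.
rewrite mulmxDl mulmxBl; apply/colP => i; by rewrite !mxE; field.
Qed.

Lemma dqm_alpha_colspace k : in_colspace (As - Ad) (alpha k).
Proof.
elim: k => [//|k [w hw]]; exists (w + (c / 2) *: x k.+1).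
by rewrite dqm_alpha_update hw mulmxDr scalemxAr.
Qed.

Lemma dqm_stepP k : dqm_step f c (As - Ad) (As + Ad)
  (x k) (z k) (alpha k) (x k.+1) (z k.+1) (alpha k.+1).
Proof.
split; [exact: dqm_primal|exact: dqm_primal|exact: dqm_alpha_colspace
  |exact: dqm_alpha_update|].
have [+ _ _] := hDQM k; apply: etrans; rewrite -!addrA; congr (_ + (_ + _)).
rewrite dqm_dual_antisym trmx_A_mul_antisym residualE trmx_A_mul.
have [ha hb] := dqm_dual_update k.
set u := As *m x k.+1 - z k.+1 in ha; set v := Ad *m x k.+1 - z k.+1 in hb.
(* As the residual blocks are opposite, As^T u + Ad^T v = (As - Ad)^T u, which turns alpha_k into
   alpha_{k+1}; what remains is c (As + Ad)^T (z_{k+1} - z_k). *)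
have uv : u = - v.
  apply/eqP; rewrite -addr_eq0 /u /v addrACA -mulmxDl dqm_primal -opprD.
  by rewrite scaler_nat mulr2n subrr.
rewrite ha [_ *m (alpha k + _)]mulmxDr -addrA -scalemxAr -scalerDr.
congr (_ + c *: _).
rewrite [(As - Ad)^T]linearB [(As + Ad)^T]linearD /= mulmxBl mulmxDl.
rewrite {2}uv mulmxN opprK.
rewrite addrACA -!mulmxDr /u /v.
by congr (_ + _); congr (_ *m _); rewrite subrKA.
Qed.

End Recursion.

(** * Translation to the stated norms, and the convergence theorem *)

Lemma sqr_enorm (R : realType) N (v : 'cV[R]_N) : enorm v ^+ 2 = dot v v.
Proof. by rewrite sqr_sqrtr // dot_ge0. Qed.

Lemma wnorm2_C_mx (R : realType) N (c : R) (a b a' b' : 'cV[R]_N) :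
  wnorm2 (C_mx N c) (col_mx a b - col_mx a' b') =
    c * dot (a - a') (a - a') + c^-1 * dot (b - b') (b - b').
Proof.
rewrite opp_col_mx add_col_mx /wnorm2 tr_col_mx mul_row_block mul_row_col.
rewrite !mulmx0 addr0 add0r !mul_mx_scalar -!scalemxAl mxE.
by congr (_ + _); rewrite mxE.
Qed.

Unset Implicit Arguments.
Set Strict Implicit.

Theorem corollary1 (R : realType) (n p : nat) (E : {set 'I_n * 'I_n})
  (hsym : symmetric_edges E) (hconn : connected_network E)
  (fi : 'I_n -> 'cV[R]_p -> R)
  (c m M L gu Gu go : R)
  (xs : 'cV[R]_(bdim n p)) (zs alphas : 'cV[R]_(bdim #|E| p))
  (x : nat -> 'cV[R]_(bdim n p)) (z alpha beta : nat -> 'cV[R]_(bdim #|E| p))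
  (hsol : is_solution (aggregate_cost fi) (A_mx R p E) (B_mx R p E) xs zs)
  (hmult_col : in_colspace (E_o R p E) alphas)
  (hmult : grad (aggregate_cost fi) xs
             + (A_mx R p E)^T *m col_mx alphas (- alphas) = 0)
  (hc : 0 < c)
  (hDQM : DQM (aggregate_cost fi) (A_mx R p E) (B_mx R p E) c x z
            (fun k => col_mx (alpha k) (beta k)))
  (hinit_dual : alpha 0%N = - beta 0%N)
  (hinit_primal : E_u R p E *m x 0%N = 2 *: z 0%N)
  (hinit_col : in_colspace (E_o R p E) (alpha 0%N))
  (hgu : 0 < gu)
  (hEu : forall s : R, singular_value (E_u R p E) s -> gu <= s <= Gu)
  (hgo : 0 < go)
  (hEo : singular_value (E_o R p E) go)
  (hEo_min : forall s : R, singular_value (E_o R p E) s -> s != 0 -> go <= s)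
  (hdiff : forall i, twice_differentiable (fi i))
  (hm : 0 < m) (hmM : m <= M)
  (hhess : forall (i : 'I_n) (y : 'cV[R]_p),
     loewner_le m%:M (hessian (fi i) y) /\ loewner_le (hessian (fi i) y) M%:M)
  (hlip : forall (i : 'I_n) (y y' : 'cV[R]_p),
     spectral_norm (hessian (fi i) y - hessian (fi i) y') <= L * enorm (y - y'))
  (hcbig : c > 4 * M ^+ 2 / (m * gu ^+ 2)) :
  let bound (k : nat) : R :=
    4 / (c * gu ^+ 2) * wnorm2 (C_mx (bdim #|E| p) c)
                          (col_mx (z k) (alpha k) - col_mx zs alphas) in
  [/\ R_linear_to_zero (fun k => enorm (x k - xs) ^+ 2),
      linear_to_zero bound
    & forall k : nat, enorm (x k - xs) ^+ 2 <= bound k].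
Proof.
have [EuXs EoXs] := feasibleE hsol.1.
have hF := aggregate_twice_differentiable hdiff.
have hlo y := aggregate_hessian_ge hdiff y (fun i w => (hhess i w).1).
have hup y := aggregate_hessian_le hdiff y (fun i w => (hhess i w).2).
have hEu2 := mulmx_singular_lower_bound hgu
  (fun s hs => proj1 (andP (hEu s hs))).
rewrite trmx_A_mul_antisym in hmult.
have [rho rho01 hrho] := dqm_contraction hm hmM hc hgu hF hlo hup hEu2 hcbig
  EuXs EoXs hmult_col hmult.
have hstep := dqm_stepP hc hDQM hinit_dual hinit_primal hinit_col.
have hEuk := dqm_primal hc hDQM hinit_dual hinit_primal.
have K0 : 0 < 4 / (c * gu ^+ 2) by rewrite divr_gt0 ?mulr_gt0 ?exprn_gt0.
move=> bound.
have boundE k : bound k = 4 / (c * gu ^+ 2) *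
    (c * dot (z k - zs) (z k - zs)
       + c^-1 * dot (alpha k - alphas) (alpha k - alphas)).
  by rewrite /bound wnorm2_C_mx.
have blin : linear_to_zero bound.
  exists rho => // k; rewrite !boundE; split.
    apply: mulr_ge0 (ltW K0) _.
    by rewrite addr_ge0 // mulr_ge0 ?dot_ge0 ?invr_ge0 ?(ltW hc).
  by rewrite [leRHS]mulrCA ler_pM2l //; exact/hrho/hstep.
have hx k : enorm (x k - xs) ^+ 2 <= bound k.
  rewrite sqr_enorm boundE.
  (* Follows from Eu (x_k - xs) = 2 (z_k - zs); the alpha part of the energy is then added as a
     nonnegative term. *)
  have hk : gu ^+ 2 * dot (x k - xs) (x k - xs)
      <= 4 * dot (z k - zs) (z k - zs).
    apply: le_trans (hEu2 _) _.
    rewrite mulmxBr [E_u _ _ _ *m x k]hEuk [E_u _ _ _ *m xs]EuXs -scalerBr.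
    by rewrite dotZl dotZr mulrA ler_wpM2r ?dot_ge0 // -natrM.
  have a0 : 0 <= c^-1 * dot (alpha k - alphas) (alpha k - alphas).
    by rewrite mulr_ge0 ?dot_ge0 ?invr_ge0 // ltW.
  rewrite mulrAC ler_pdivlMr ?mulr_gt0 ?exprn_gt0 //.
  have : c * (gu ^+ 2 * dot (x k - xs) (x k - xs))
      <= c * (4 * dot (z k - zs) (z k - zs)) by rewrite ler_pM2l.
  lra.
(* The scaled energy itself is the dominating linearly convergent sequence. *)
split=> //; exists bound => // k.
by rewrite ger0_norm ?sqr_ge0.
Qed.
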